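(* The problem Perfect Matching Cut is solvable in polynomial time on bipartite graphs of diameter at most $3$.
   Context: Graphs are finite, simple and undirected. The distance $\mathrm{dist}(u,v)$ is the length of a shortest path from $u$ to $v$; a graph has diameter at most $k$ if $\mathrm{dist}(u,v)\le k$ for all vertices $u,v$ (in particular such a graph is connected). A matching $M\subseteq E(G)$ is a set of pairwise non-adjacent edges; it is perfect if every vertex of $G$ is incident to an edge of $M$. A matching $M$ is a matching cut of $G$ if there is a partition $A\cup B=V(G)$ such that the edges of $M$ are exactly the edges of $G$ with one endvertex in $A$ and one in $B$. A perfect matching cut is a perfect matching that is also a matching cut. The decision problem Perfect Matching Cut takes a graph $G$ as input and asks whether $G$ has a perfect matching cut. *)

(* Defs.v *)
From mathcomp Require Import all_boot.

Set Implicit Arguments.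
Unset Strict Implicit.
Unset Printing Implicit Defensive.

Record sgraph (V : finType) := SGraph {
  adj :> rel V;
  adj_sym : symmetric adj;
  adj_irrefl : irreflexive adj
}.

Section GraphNotions.

Variables (V : finType) (G : sgraph V).

Definition edges : {set {set V}} :=
  [set f : {set V} | [exists u, exists v, adj G u v && (f == [set u; v])]].

Definition bipartite : Prop :=
  exists X : {set V}, forall u v, adj G u v -> (u \in X) != (v \in X).

(* As in path.v, [u :: p] is the vertex sequence of the path, so [size p] is
   its number of edges. *)
Definition path_of_length (u v : V) (d : nat) : Prop :=
  exists p : seq V,
    [/\ path (adj G) u p, uniq (u :: p), last u p = v & size p = d].

(* Distance as a relation: no [d] satisfies it when [u] and [v] lie in
   different components. *)
Definition is_dist (u v : V) (d : nat) : Prop :=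
  path_of_length u v d /\ forall d', path_of_length u v d' -> d <= d'.

Definition diameter_at_most (k : nat) : Prop :=
  forall u v : V, exists2 d, is_dist u v d & d <= k.

Definition matching (M : {set {set V}}) : Prop :=
  M \subset edges /\ {in M &, forall f g : {set V}, f != g -> [disjoint f & g]}.

Definition perfect_matching (M : {set {set V}}) : Prop :=
  matching M /\ forall v : V, exists2 f, f \in M & v \in f.

Definition edges_between (A B : {set V}) : {set {set V}} :=
  [set f in edges | [exists u in A, exists v in B, f == [set u; v]]].

Definition matching_cut (M : {set {set V}}) : Prop :=
  matching M /\
  exists A B : {set V},
    [/\ A :|: B = [set: V], [disjoint A & B] & M = edges_between A B].

Definition perfect_matching_cut (M : {set {set V}}) : Prop :=
  perfect_matching M /\ matching_cut M.

Definition has_perfect_matching_cut : Prop :=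
  exists M : {set {set V}}, perfect_matching_cut M.

End GraphNotions.

(* The machine model is a random access machine on natural numbers, programmed
   with structured control: scalar registers [Var x], and unbounded arrays
   accessed by computed index ([Fetch a e] is cell [e] of array [a]).  Its only
   arithmetic is addition and truncated subtraction.  As there is no
   multiplication, a run of t steps only handles numbers of O(t + log n) bits,
   so this time measure is polynomially equivalent to Turing machine time. *)
Inductive expr : Type :=
| Const of nat
| Var of nat
| Fetch of nat & expr
| Add of expr & expr
| Sub of expr & expr.

Inductive cmd : Type :=
| Skip
| Assign of nat & expr
| Store of nat & expr & expr
| Seq of cmd & cmd
| If of expr & cmd & cmd
| While of expr & cmd.

Record state := State { reg : nat -> nat; arr : nat -> nat -> nat }.

Fixpoint eval (s : state) (e : expr) : nat :=
  match e with
  | Const c => c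
  | Var x => reg s x
  | Fetch a e1 => arr s a (eval s e1)
  | Add e1 e2 => eval s e1 + eval s e2
  | Sub e1 e2 => eval s e1 - eval s e2
  end.

Fixpoint expr_cost (e : expr) : nat :=
  match e with
  | Const _ | Var _ => 1
  | Fetch _ e1 => (expr_cost e1).+1
  | Add e1 e2 | Sub e1 e2 => (expr_cost e1 + expr_cost e2).+1
  end.

Definition set_reg (s : state) (x v : nat) : state :=
  State (fun y => if y == x then v else reg s y) (arr s).

Definition set_arr (s : state) (a i v : nat) : state :=
  State (reg s)
    (fun b j => if (b == a) && (j == i) then v else arr s b j).

(* [exec c s t s']: started in state [s], [c] halts in state [s'] after exactly
   [t] steps.  A test succeeds when its value is nonzero. *)
Inductive exec : cmd -> state -> nat -> state -> Prop :=
| exec_skip s : exec Skip s 1 s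
| exec_assign s x e :
    exec (Assign x e) s (expr_cost e).+1 (set_reg s x (eval s e))
| exec_store s a i e :
    exec (Store a i e) s (expr_cost i + expr_cost e).+1
      (set_arr s a (eval s i) (eval s e))
| exec_seq c1 c2 s1 s2 s3 t1 t2 :
    exec c1 s1 t1 s2 -> exec c2 s2 t2 s3 -> exec (Seq c1 c2) s1 (t1 + t2) s3
| exec_if_true e c1 c2 s s' t :
    eval s e != 0 -> exec c1 s t s' ->
    exec (If e c1 c2) s ((expr_cost e).+1 + t) s'
| exec_if_false e c1 c2 s s' t :
    eval s e = 0 -> exec c2 s t s' ->
    exec (If e c1 c2) s ((expr_cost e).+1 + t) s'
| exec_while_true e c s1 s2 s3 t1 t2 :
    eval s1 e != 0 -> exec c s1 t1 s2 -> exec (While e c) s2 t2 s3 ->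
    exec (While e c) s1 ((expr_cost e).+1 + t1 + t2) s3
| exec_while_false e c s :
    eval s e = 0 -> exec (While e c) s (expr_cost e).+1 s.

(* The input graph has vertices 0, ..., n-1.  Register 0 holds n, and array 0
   holds the adjacency matrix in row-major order; everything else is 0. *)
Definition input (n : nat) (G : sgraph 'I_n) : state :=
  State (fun x => if x == 0 then n else 0)
    (fun a k => if a == 0 then
       nat_of_bool [exists i : 'I_n, exists j : 'I_n,
                      (k == i * n + j) && adj G i j]
     else 0).

Definition graph_property := forall V : finType, sgraph V -> Prop.

(* The graph problem Q, restricted to instances in the class C, is solvable in
   time polynomial in the number of vertices (equivalently, in the size of the
   adjacency matrix).  The program accepts by leaving a nonzero value in
   register 0.  [exec] being deterministic, there is at most one run. *)
Definition poly_time_solvable_on (C Q : graph_property) : Prop :=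
  exists (prog : cmd) (c k : nat), forall (n : nat) (G : sgraph 'I_n),
    C _ G ->
    exists (t : nat) (s : state),
      [/\ exec prog (input G) t s,
          t <= c * n ^ k + c
        & reg s 0 != 0 <-> Q _ G].

(* Main.v *)
Require Import Defs.
From mathcomp Require Import all_boot.
From mathcomp Require Import zify.

Set Implicit Arguments.
Unset Strict Implicit.
Unset Printing Implicit Defensive.

(** A graph has a perfect matching cut iff its vertices can be split into two
    sides, A and its complement, so that every vertex v has exactly one
    neighbour on the other side, its mate
    ([has_perfect_matching_cutP]).  The sides will be called colours.

    In a bipartite graph of diameter at most 3, a perfect matching cut is
    determined by at most eight of its edges ([eight_edges_suffice]).  When the
    edge from a to its mate is known to belong to the cut, so is the colour of
    every neighbour of either end: the neighbours of a other than the mate have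
    the colour of a.  Also, a vertex with two distinct neighbours of the same
    colour has that colour, because only one of them could be its mate.  These
    two rules, each applied once, colour everything.  Indeed two vertices in
    the same part of the bipartition have a common neighbour.  Take x and x'
    in one part, coloured differently, and suppose that the cut edges at x and
    x' are known.  A vertex w of that part that is not yet coloured has a
    coloured neighbour of the colour of x (a common neighbour with x) and one
    of the colour of x', and only one of each if the second rule does not apply
    to w.  Let u be one such undetermined vertex and p, q its two coloured
    neighbours.  One of p, q is the mate of u, so the cut edges at p and q
    reveal all neighbours of u, p and q.  Any other undetermined w has a
    common neighbour z with u: either z is p or q, and then w is a neighbour of
    it, or z and the coloured neighbour of w that has the colour of z are two
    distinct neighbours, and the second rule applies ([side_spread]).  Hence
    four edges suffice for each part.

    The algorithm enumerates all sequences of eight pairs of vertices, treats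
    them as cut edges, propagates the colours with the two rules, and checks
    whether the result is a perfect matching cut.  The check makes acceptance
    sound whatever was guessed, and the right guess is found when there is a
    cut.

    To run this on the machine, programs are written in a small language whose
    only loops are bounded by the number of vertices.  Such a program is a
    function on states ([den]), its compiled code runs in polynomial time
    whatever it computes ([compile_correct]), and so correctness is a
    statement about functions only ([decide_correct]). *)

(** * Perfect matching cuts as two-colourings *)

Section CutSides.

Variables (V : finType) (G : sgraph V).

Definition mates (A : {set V}) (v : V) : {set V} :=
  [set w | adj G v w & (w \in A) != (v \in A)].

Definition cut_side (A : {set V}) : Prop := forall v, #|mates A v| = 1.

Lemma edges_betweenP (A B : {set V}) (f : {set V}) :
  reflect (exists u v, [/\ u \in A, v \in B, adj G u v & f = [set u; v]])
          (f \in edges_between G A B).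
Proof.
apply: (iffP idP) => [|[u [v [uA vB uv ->]]]].
  rewrite !inE => /andP[/existsP[a /existsP[b /andP[ab /eqP fab]]]].
  case/existsP=> u /andP[uA /existsP[v /andP[vB /eqP fuv]]].
  exists u, v; split=> //.
  have [] : a \in [set u; v] /\ b \in [set u; v].
    by rewrite -fuv fab !inE !eqxx orbT.
  have [] : u \in [set a; b] /\ v \in [set a; b].
    by rewrite -fab fuv !inE !eqxx orbT.
  rewrite !inE => h1 h2 h3 h4.
  case/orP: h3 => /eqP ea; case/orP: h4 => /eqP eb; subst a b.
  - by rewrite adj_irrefl in ab.
  - by [].
  - by rewrite adj_sym.
  - by rewrite adj_irrefl in ab.
rewrite !inE; apply/andP; split.
  by apply/existsP; exists u; apply/existsP; exists v; rewrite uv eqxx.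
apply/existsP; exists u; rewrite uA /=.
by apply/existsP; exists v; rewrite vB eqxx.
Qed.

(** The edges of the cut at v correspond to the neighbours of v on the other
    side; being a matching means at most one for each v, being perfect means at
    least one. *)
Lemma has_perfect_matching_cutP :
  has_perfect_matching_cut G <-> exists A, cut_side A.
Proof.
split=> [[M [[[_ disM] perM] [_ [A [B [AB dAB defM]]]]]]|[A mA]].
  have inB v : (v \in B) = (v \notin A).
    have := in_setT v; rewrite -AB inE.
    case: (boolP (v \in A)) => [vA _|_ /=]; last by [].
    by apply/negbTE; rewrite (disjointFr dAB).
  exists A => v.
  have [f fM vf] := perM v.
  have [w vw]: exists w, w \in mates A v.
    move: fM vf; rewrite defM => /edges_betweenP[a [b [aA bB ab ->]]].
    rewrite inB in bB; rewrite !inE.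
    case/orP=> /eqP->; [exists b|exists a]; rewrite inE ?(negbTE bB) aA.
      by rewrite ab.
    by rewrite adj_sym ab.
  apply/eqP/cards1P; exists w; apply/setP=> w'; rewrite inE.
  apply/idP/eqP=> [vw'|->//].
  have inM z : z \in mates A v -> [set v; z] \in M.
    rewrite inE defM => /andP[vz]; case: (boolP (v \in A)) => vA zA.
      by apply/edges_betweenP; exists v, z; rewrite inB; split=> //; case: (z \in A) zA.
    apply/edges_betweenP; exists z, v; rewrite inB setUC adj_sym; split=> //.
    by case: (z \in A) zA.
  apply/eqP; apply: contraT => neq.
  have neqf : [set v; w] != [set v; w'].
    apply: contraNneq neq => /setP/(_ w'); rewrite !inE eqxx orbT.
    case/orP=> /eqP e; last by rewrite e.
    by move: vw'; rewrite e inE adj_irrefl.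
  have := disM _ _ (inM _ vw) (inM _ vw') neqf.
  by move/disjointFr/(_ (set21 _ _)); rewrite set21.
pose M := edges_between G A (~: A).
have uniq_mate v w w' : w \in mates A v -> w' \in mates A v -> w = w'.
  by have /eqP/cards1P[z ->] := mA v; rewrite !inE => /eqP-> /eqP->.
have edgeM f v : f \in M -> v \in f -> exists2 w, w \in mates A v & f = [set v; w].
  case/edges_betweenP=> a [b [aA]]; rewrite inE => bA ab ->.
  rewrite !inE; case/orP=> /eqP->; [exists b|exists a] => //.
  - by rewrite inE ab aA (negbTE bA).
  - by rewrite inE adj_sym ab aA (negbTE bA).
  - by rewrite setUC.
have matM : matching G M.
  split=> [|f g fM gM neq].
    by apply/subsetP=> f; rewrite inE => /andP[].
  apply: contraT => /pred0Pn[v /andP[/= vf vg]].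
  have [w vw ef] := edgeM f v fM vf; have [w' vw' eg] := edgeM g v gM vg.
  by move: neq; rewrite ef eg (uniq_mate v w w') ?eqxx.
exists M; split; split=> //; last first.
  by exists A, (~: A); split; rewrite ?setUCr // -subsets_disjoint.
move=> v; have /eqP/cards1P[w ew] := mA v.
have: w \in mates A v by rewrite ew set11.
rewrite inE => /andP[vw wv]; exists [set v; w]; last exact: set21.
apply/edges_betweenP; case: (boolP (v \in A)) wv => vA wA.
  by exists v, w; rewrite inE; split=> //; case: (w \in A) wA.
exists w, v; rewrite inE setUC adj_sym; split=> //.
by case: (w \in A) wA.
Qed.

End CutSides.

(** * Eight edges determine the cut *)

Section Reconstruction.

Variables (V : finType) (G : sgraph V).
Hypotheses (bipG : bipartite G) (diamG : diameter_at_most G 3).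
Variable A : {set V}.
Hypothesis cutA : cut_side G A.

Definition mate (v : V) : V := odflt v [pick w in mates G A v].

Lemma mate_in v : mate v \in mates G A v.
Proof.
rewrite /mate; case: pickP => //= none.
by have := cutA v; rewrite (eq_card0 none).
Qed.

Lemma mate_adj v : adj G v (mate v).
Proof. by have := mate_in v; rewrite inE => /andP[]. Qed.

Lemma mate_opposite v : (mate v \in A) = (v \notin A).
Proof.
by have := mate_in v; rewrite inE => /andP[_]; case: (_ \in A); case: (_ \in A).
Qed.

Lemma mateE v w : adj G v w -> (w \in A) != (v \in A) -> w = mate v.
Proof.
move=> vw opp; have := mate_in v; have: w \in mates G A v by rewrite inE vw.
by have /eqP/cards1P[z ->] := cutA v; rewrite !inE => /eqP-> /eqP.
Qed.

Lemma mateK : involutive mate.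
Proof.
move=> v; apply/esym/mateE; first by rewrite adj_sym mate_adj.
by rewrite mate_opposite; case: (_ \in A).
Qed.

(** The vertices whose colour is known once the vertices of s, their mates and
    the colours of s are known.  Every a in s and its mate belong to it, each
    being a neighbour of the other. *)
Definition reach (s : seq V) : {set V} :=
  [set v | has (fun a => adj G a v || adj G (mate a) v) s].

(** One round of the rule that two neighbours of the same colour impose their
    colour. *)
Definition spread (D : {set V}) : {set V} :=
  D :|: [set v | [exists i in D, exists j in D,
    [&& i != j, adj G v i, adj G v j & (i \in A) == (j \in A)]]].

Lemma reach_cat s1 s2 : reach (s1 ++ s2) = reach s1 :|: reach s2.
Proof. by apply/setP=> v; rewrite !inE has_cat. Qed.

Lemma reach_sub s1 s2 : {subset s1 <= s2} -> reach s1 \subset reach s2.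
Proof.
move=> s12; apply/subsetP=> v; rewrite !inE => /hasP[a as1 av].
by apply/hasP; exists a; first exact: s12.
Qed.

Lemma reach_adj s a v : a \in s -> adj G a v -> v \in reach s.
Proof. by move=> sa av; rewrite inE; apply/hasP; exists a; rewrite ?av. Qed.

Lemma reach_mate_adj s a v : a \in s -> adj G (mate a) v -> v \in reach s.
Proof. by move=> sa av; rewrite inE; apply/hasP; exists a; rewrite ?av ?orbT. Qed.

Lemma spreadS (D E : {set V}) : D \subset E -> spread D \subset spread E.
Proof.
move=> /subsetP DE; apply/subsetP=> v; rewrite !inE.
case/orP=> [/DE->//|/existsP[i /andP[/DE Di /existsP[j /andP[/DE Dj ij]]]]].
apply/orP; right; apply/existsP; exists i; rewrite Di.
by apply/existsP; exists j; rewrite Dj.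
Qed.

Lemma spread2 (D : {set V}) v i j :
  i \in D -> j \in D -> i != j -> adj G v i -> adj G v j ->
  (i \in A) = (j \in A) -> v \in spread D.
Proof.
move=> iD jD ij vi vj eA; rewrite !inE; apply/orP; right.
by apply/existsP; exists i; rewrite iD; apply/existsP; exists j; rewrite jD ij vi vj eA eqxx.
Qed.

(** By parity, the distance between two vertices of the same part is 0 or 2. *)
Lemma common_neighbour (X : {set V}) :
  (forall u v, adj G u v -> (u \in X) != (v \in X)) ->
  forall u v, (u \in X) = (v \in X) -> exists2 z, adj G u z & adj G z v.
Proof.
move=> bipX u v uv; have [d [[p [pp _ lp sp]] _] d3] := diamG u v.
have alt a b : adj G a b -> (b \in X) = (a \notin X).
  by move=> /bipX; case: (_ \in X); case: (_ \in X).
case: p pp lp sp => [|a [|b [|c [|e p]]]] /= pp lp sp.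
- by rewrite -lp; exists (mate u); rewrite ?(adj_sym G (mate u)) mate_adj.
- by move: pp; rewrite lp andbT => /alt; rewrite uv; case: (_ \in X).
- by case/and3P: pp => ua ab _; exists a; rewrite // -lp.
- case/and4P: pp => /alt ua /alt ab /alt bc _.
  by move: bc; rewrite lp ab ua uv !negbK; case: (_ \in X).
- by move: d3; rewrite -sp.
Qed.

(** The seeds are x, a vertex x' of the same part with the other colour, and the
    two coloured neighbours p, q of a vertex u that x and x' leave undetermined.
    If there is no such x', or no such u, then the seeds already chosen suffice
    and are repeated. *)
Lemma side_spread (X : {set V}) x :
  (forall u v, adj G u v -> (u \in X) != (v \in X)) ->
  exists2 s, size s = 4 & forall w, (w \in X) = (x \in X) -> w \in spread (reach s).
Proof.
move=> bipX; have common := common_neighbour bipX.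
have [/existsP[x' /andP[/eqP x'X x'A]]|none] :=
    boolP [exists x', ((x' \in X) == (x \in X)) && ((x' \in A) != (x \in A))]; last first.
  exists [:: x; x; x; x] => // w wX; have [z xz zw] := common x w (esym wX).
  (* A common neighbour z of the colour of x would have its mate in the part
     of x, with the other colour. *)
  suff ez: z = mate x.
    by rewrite inE (@reach_mate_adj _ x) ?mem_head // -ez.
  apply: mateE => //; apply: contraNneq none => zA.
  apply/existsP; exists (mate z); rewrite mate_opposite zA.
  have /bipX := mate_adj z; have /bipX := xz.
  by case: (x \in X); case: (z \in X); case: (_ \in X); case: (x \in A).
pose N := reach [:: x; x'].
have near y w : y \in [:: x; x'] -> (w \in X) = (x \in X) -> w \notin N ->
    exists z, [/\ z \in N, adj G w z & (z \in A) = (y \in A)].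
  move=> yx wX wN; have yX: (y \in X) = (w \in X).
    by move: yx; rewrite !inE => /orP[] /eqP->; rewrite ?x'X wX.
  have [z yz zw] := common y w yX; exists z; split.
  - exact: reach_adj yz.
  - by rewrite adj_sym.
  apply/eqP; apply: contraNT wN => zA; apply: (reach_mate_adj yx).
  by rewrite -(mateE yz zA).
have x's : x' \in [:: x; x'] by rewrite !inE eqxx orbT.
have NS p q : N \subset reach [:: x; x'; p; q].
  by apply: reach_sub => a; rewrite !inE => /orP[]->; rewrite ?orbT.
have [/existsP[u /andP[/eqP uX uN]]|all] :=
    boolP [exists u, ((u \in X) == (x \in X)) && (u \notin spread N)]; last first.
  exists [:: x; x'; x; x] => // w wX; apply: (subsetP (spreadS (NS _ _))).
  by apply: contraNT all => wN; apply/existsP; exists w; rewrite wX eqxx.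
have uN1: u \notin N by apply: contraNN uN => uN; rewrite inE uN.
have [p [pN up pA]] := near x u (mem_head _ _) uX uN1.
have [q [qN uq qA]] := near x' u x's uX uN1.
exists [:: x; x'; p; q] => // w wX.
set D := reach _; have ND: N \subset D := NS p q.
have [wD|wD] := boolP (w \in D); first by rewrite inE wD.
have wN: w \notin N by apply: contraNN wD; apply: (subsetP ND).
(* The mate of u is p or q, namely the one whose colour is not that of u. *)
have uD z : adj G u z -> z \in D.
  have [e|e] := eqVneq (u \in A) (x \in A) => uz.
    apply: (@reach_mate_adj _ q); first by rewrite !inE eqxx !orbT.
    by rewrite (mateE uq) ?mateK // qA e.
  apply: (@reach_mate_adj _ p); first by rewrite !inE eqxx !orbT.
  by rewrite (mateE up) ?mateK // pA eq_sym.
have [z uz zw] := common u w (etrans uX (esym wX)).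
have finish y r : y \in [:: x; x'] -> r \in [:: p; q] -> r \in N -> adj G u r ->
    (r \in A) = (y \in A) -> (z \in A) = (y \in A) -> w \in spread D.
  move=> yx rpq rN ur rA zA; have [z' [z'N wz' z'A]] := near y w yx wX wN.
  have [ez|nz] := eqVneq z z'; last first.
    apply: (spread2 (uD z uz) (subsetP ND _ z'N) nz) => //.
      by rewrite adj_sym.
    by rewrite zA.
  have [er|nr] := eqVneq z r.
    case/negP: wD; apply: (@reach_adj _ r); last by rewrite -er.
    by move: rpq; rewrite !inE => /orP[]->; rewrite ?orbT.
  case/negP: uN; apply: (spread2 _ rN nr uz ur); first by rewrite ez.
  by rewrite zA.
have [zA|zA] := eqVneq (z \in A) (x \in A).
  by apply: (finish x p) => //; rewrite mem_head.
apply: (finish x' q) => //; first by rewrite !inE eqxx orbT.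
by move: zA x'A; case: (z \in A); case: (x \in A); case: (_ \in A).
Qed.

(** One application of [side_spread] for each part, represented by v0 and by
    its mate.  A seed may be replaced by its mate without changing [reach], so
    all of them can be taken in A. *)
Lemma eight_edges_suffice (v0 : V) :
  exists2 s : seq V, size s = 8 /\ {subset s <= A} & spread (reach s) = [set: V].
Proof.
have [X bipX] := bipG.
have [s1 sz1 sp1] := side_spread v0 bipX.
have [s2 sz2 sp2] := side_spread (mate v0) bipX.
pose s := s1 ++ s2; pose toA v := if v \in A then v else mate v.
exists [seq toA v | v <- s].
  split; first by rewrite size_map size_cat sz1 sz2.
  move=> _ /mapP[v _ ->]; rewrite /toA; case: ifP => // vA.
  by rewrite mate_opposite vA.
have ->: reach [seq toA v | v <- s] = reach s.
  apply/setP=> v; rewrite !inE has_map; apply: eq_has => a /=.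
  by rewrite /toA; case: ifP => //; rewrite mateK orbC.
apply/eqP; rewrite eqEsubset subsetT; apply/subsetP=> w _.
have [wX|wX] := eqVneq (w \in X) (v0 \in X).
  by apply: (subsetP (spreadS _) w (sp1 w wX)); rewrite reach_cat subsetUl.
apply: (subsetP (spreadS _) w (sp2 w _)); first by rewrite reach_cat subsetUr.
have /bipX := mate_adj v0.
by move: wX; case: (w \in X); case: (v0 \in X); case: (_ \in X).
Qed.

End Reconstruction.

(** * Programs with bounded loops run in polynomial time *)

(** Without unbounded loops every program halts, in a time that is polynomial
    because of its syntax alone. *)
Inductive prog : Type :=
| PAssign of nat & expr
| PStore of nat & expr & expr
| PSeq of prog & prog
| PWhen of expr & prog
| PFor of nat & prog.

Fixpoint compile (p : prog) : cmd :=
  match p with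
  | PAssign x e => Assign x e
  | PStore a i e => Store a i e
  | PSeq p q => Seq (compile p) (compile q)
  | PWhen e p => If e (compile p) Skip
  | PFor x p =>
      Seq (Assign x (Const 0))
        (While (Defs.Sub (Var 0) (Var x))
           (Seq (compile p) (Assign x (Add (Var x) (Const 1)))))
  end.

Fixpoint den (p : prog) (s : state) : state :=
  match p with
  | PAssign x e => set_reg s x (eval s e)
  | PStore a i e => set_arr s a (eval s i) (eval s e)
  | PSeq p q => den q (den p s)
  | PWhen e p => if eval s e != 0 then den p s else s
  | PFor x p =>
      iter (reg s 0) (fun s => let s := den p s in set_reg s x (reg s x + 1))
        (set_reg s x 0)
  end.

Fixpoint wregs (p : prog) : seq nat :=
  match p with
  | PAssign x _ => [:: x]
  | PStore _ _ _ => [::]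
  | PSeq p q => wregs p ++ wregs q
  | PWhen _ p => wregs p
  | PFor x p => x :: wregs p
  end.

Fixpoint warrs (p : prog) : seq nat :=
  match p with
  | PAssign _ _ => [::]
  | PStore a _ _ => [:: a]
  | PSeq p q => warrs p ++ warrs q
  | PWhen _ p | PFor _ p => warrs p
  end.

(** Writing the counter of an enclosing loop would spoil the number of its
    iterations.  Register 0 may be written only where nothing comes after, so
    that all loop bounds are its initial value. *)
Fixpoint wf (p : prog) : bool :=
  match p with
  | PAssign _ _ | PStore _ _ _ => true
  | PSeq p q => [&& 0 \notin wregs p, wf p & wf q]
  | PWhen _ p => wf p
  | PFor x p => [&& 0 \notin x :: wregs p, x \notin wregs p & wf p]
  end.

Definition unchanged (rs ars : seq nat) (s s' : state) : Prop :=
  (forall y, y \notin rs -> reg s' y = reg s y) /\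
  (forall a j, a \notin ars -> arr s' a j = arr s a j).

Lemma unchanged_trans rs ars s1 s2 s3 :
  unchanged rs ars s1 s2 -> unchanged rs ars s2 s3 -> unchanged rs ars s1 s3.
Proof.
move=> [r12 a12] [r23 a23]; split=> [y yr|a j ar].
  by rewrite r23 // r12.
by rewrite a23 // a12.
Qed.

Lemma unchanged_set_reg rs ars s s' x v :
  x \in rs -> unchanged rs ars s s' -> unchanged rs ars s (set_reg s' x v).
Proof.
move=> xr [r12 a12]; split=> //= y yr; rewrite ifN ?r12 //.
by apply: contraNneq yr => ->.
Qed.

Lemma unchangedS rs rs' ars ars' s s' :
  {subset rs <= rs'} -> {subset ars <= ars'} ->
  unchanged rs ars s s' -> unchanged rs' ars' s s'.
Proof.
move=> rS aS [rU aU]; split=> [y yr|a j ar].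
  by apply: rU; apply: contraNN yr => /rS.
by apply: aU; apply: contraNN ar => /aS.
Qed.

Lemma den_unchanged p s : unchanged (wregs p) (warrs p) s (den p s).
Proof.
elim: p s => [x e|a i e|p IHp q IHq|e p IHp|x p IHp] s /=.
- by apply: unchanged_set_reg; rewrite ?mem_head.
- by split=> //= b j; rewrite inE => /negbTE->.
- apply: unchanged_trans (unchangedS _ _ (IHp s)) (unchangedS _ _ (IHq _));
    by move=> y; rewrite mem_cat => ->; rewrite ?orbT.
- by case: ifP => // _; apply: IHp.
- elim: (reg s 0) => [|k IHk] /=; apply: unchanged_set_reg; rewrite ?mem_head //.
  apply: unchanged_trans IHk (unchangedS _ _ (IHp _)) => // y yr.
  by rewrite inE yr orbT.
Qed.

Lemma den_reg p s y : y \notin wregs p -> reg (den p s) y = reg s y.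
Proof. exact: (den_unchanged p s).1. Qed.

(** Every loop is run as many times as register 0 says, so each level of nesting
    raises the degree d by one.  For a sequence the sum of both degrees is a
    crude bound that serves. *)
Lemma compile_correct p :
  wf p -> exists K d, forall s,
    exists2 t, exec (compile p) s t (den p s) & t <= K * (reg s 0).+1 ^ d.
Proof.
elim: p => [x e|a i e|p IHp q IHq|e p IHp|x p IHp] /=.
- by move=> _; exists (expr_cost e).+1, 0 => s; exists (expr_cost e).+1;
    [exact: exec_assign|rewrite muln1].
- move=> _; exists (expr_cost i + expr_cost e).+1, 0 => s.
  by exists (expr_cost i + expr_cost e).+1; [exact: exec_store|rewrite muln1].
- case/and3P=> p0 /IHp[K [d Hp]] /IHq[L [e Hq]]; exists (K + L), (d + e) => s.
  have [t et lt] := Hp s; have [u eu lu] := Hq (den p s).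
  exists (t + u); first exact: exec_seq et eu.
  rewrite den_reg // in lu.
  rewrite mulnDl leq_add // ?(leq_trans lt) ?(leq_trans lu) // leq_mul2l leq_pexp2l //;
    by rewrite ?orbT ?leq_addl ?leq_addr ?orbT.
- case/IHp=> K [d Hp]; exists (K + (expr_cost e).+2), d => s.
  have pos: 0 < (reg s 0).+1 ^ d by rewrite expn_gt0.
  case: ifPn => [ne|/negPn/eqP e0].
    have [t et lt] := Hp s; exists ((expr_cost e).+1 + t).
      exact: exec_if_true.
    by rewrite mulnDl addnC leq_add // (@leq_trans (expr_cost e).+2) // leq_pmulr.
  exists ((expr_cost e).+1 + 1); first by apply: exec_if_false; last exact: exec_skip.
  by rewrite addn1 mulnDl (@leq_trans ((expr_cost e).+2 * (reg s 0).+1 ^ d)) ?leq_pmulr ?leq_addl.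
- rewrite inE negb_or => /and3P[/andP[x0 p0] xp /IHp[K [d Hp]]].
  (* An iteration costs 8 besides its body (4 for the test, 4 for the
     increment); entering and leaving the loop costs 2 and 4. *)
  exists (K + 14), d.+1 => s.
  pose step s := let s := den p s in set_reg s x (reg s x + 1).
  have loop k s' : reg s' 0 = reg s 0 -> reg s' x + k = reg s 0 ->
      exists2 t, exec (While (Defs.Sub (Var 0) (Var x))
                        (Seq (compile p) (Assign x (Add (Var x) (Const 1)))))
                   s' t (iter k step s')
               & t <= k * (K * (reg s 0).+1 ^ d + 8) + 4.
    elim: k s' => [|k IHk] s' s0 sx.
      exists 4 => //=; apply: (exec_while_false (e := Defs.Sub _ _)) => /=.
      by rewrite s0 -sx addn0 subnn.
    have [t et lt] := Hp s'.
    have s0' : reg (step s') 0 = reg s 0.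
      by rewrite /step /= (negbTE x0) den_reg.
    have sx' : reg (step s') x + k = reg s 0.
      by rewrite /step /= eqxx den_reg // -sx addn1 addSnnS.
    have [u eu lu] := IHk _ s0' sx'.
    exists (4 + (t + 4) + u).
      rewrite iterSr.
      apply: (exec_while_true (e := Defs.Sub _ _)) eu.
        by rewrite /= s0 -sx addKn.
      apply: exec_seq et _; exact: (exec_assign _ x (Add (Var x) (Const 1))).
    rewrite s0 in lt; rewrite mulSn; lia.
  have [t et lt] : exists2 t, exec (While (Defs.Sub (Var 0) (Var x))
          (Seq (compile p) (Assign x (Add (Var x) (Const 1)))))
        (set_reg s x 0) t (iter (reg s 0) step (set_reg s x 0))
      & t <= reg s 0 * (K * (reg s 0).+1 ^ d + 8) + 4.
    by apply: loop; rewrite /= ?eqxx // (negbTE x0).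
  exists (2 + t).
    apply: exec_seq et; exact: (exec_assign _ x (Const 0)).
  have pos: 0 < (reg s 0).+1 ^ d by rewrite expn_gt0.
  apply: (leq_trans (leq_add (leqnn 2) lt)).
  rewrite expnS; move: (reg s 0) pos => n; move: (n.+1 ^ d) => P pos.
  nia.
Qed.

(** The body may rely on everything that the loop does not write having its
    value from before the loop. *)
Lemma for_invariant n x b (I : nat -> state -> Prop) s :
  wf (PFor x b) -> reg s 0 = n -> I 0 (set_reg s x 0) ->
  (forall (i : 'I_n) s', unchanged (x :: wregs b) (warrs b) s s' ->
     reg s' x = i -> I i s' -> I i.+1 (set_reg (den b s') x i.+1)) ->
  I n (den (PFor x b) s).
Proof.
move=> /= /and3P[_ xb _] -> I0 IS.
pose step s := let s := den b s in set_reg s x (reg s x + 1).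
suff: forall k, k <= n ->
    [/\ unchanged (x :: wregs b) (warrs b) s (iter k step (set_reg s x 0)),
        reg (iter k step (set_reg s x 0)) x = k & I k (iter k step (set_reg s x 0))].
  by move=> /(_ n (leqnn n))[].
elim=> [|k IHk] kn.
  by split; rewrite /= ?eqxx //; apply: unchanged_set_reg; rewrite ?mem_head.
have [Uk xk Ik] := IHk (ltnW kn).
rewrite iterS; set s' := iter k _ _ in Uk xk Ik *.
have ex: reg (den b s') x + 1 = k.+1 by rewrite den_reg // xk addn1.
rewrite /step ex; split; last exact: (IS (Ordinal kn)).
  apply: unchanged_set_reg; rewrite ?mem_head //.
  apply: unchanged_trans Uk (unchangedS _ _ (den_unchanged b s')) => // y yb.
  by rewrite inE yb orbT.
by rewrite /= eqxx.
Qed.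

(** * The algorithm *)

(** Register 1 holds the answer, 2 is used to compute multiples of n, 3, 4 and 5
    range over vertices, 6 and 7 serve the final check, and 10, ..., 25 hold the
    guess: 10 + 2i and 11 + 2i are the ends of the i-th cut edge.  Array 0 is
    the adjacency matrix, array 1 the colouring, array 2 the offsets of the rows
    of the matrix.  Colour 1 stands for A, 2 for its complement, 0 for
    uncoloured. *)

Definition Neq (e f : expr) : expr := Add (Defs.Sub e f) (Defs.Sub f e).
Definition Edge (x y : nat) : expr := Fetch 0 (Add (Fetch 2 (Var x)) (Var y)).
Definition Colour (x : nat) : expr := Fetch 1 (Var x).
(** 1 for colours 0 and 1, and 0 for all larger ones: whatever the array contains,
    this splits the vertices into two sides. *)
Definition Side (x : nat) : expr := Defs.Sub (Const 1) (Defs.Sub (Colour x) (Const 1)).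

(** The machine cannot multiply, so the offsets v * n are tabulated by repeated
    addition. *)
Definition tabulate_rows : prog :=
  PFor 3 (PSeq (PStore 2 (Var 3) (Var 2)) (PAssign 2 (Add (Var 2) (Var 0)))).

Definition uncolour : prog := PFor 3 (PStore 1 (Var 3) (Const 0)).

(** The end y of the edge is skipped, so that each write alone is justified when
    y is the mate of x. *)
Definition mark (x y c : nat) : prog :=
  PWhen (Edge x 3) (PWhen (Neq (Var 3) (Var y)) (PStore 1 (Var 3) (Const c))).

Definition plant (a b : nat) : prog :=
  PSeq (PFor 3 (PSeq (mark a b 1) (mark b a 2)))
       (PSeq (PStore 1 (Var a) (Const 1)) (PStore 1 (Var b) (Const 2))).

Fixpoint plant_all (k : nat) : prog :=
  if k is k'.+1 then PSeq (plant_all k') (plant (10 + k'.*2) (11 + k'.*2))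
  else uncolour.

Definition propagate : prog :=
  PFor 3 (PFor 4 (PFor 5
    (PWhen (Edge 3 4) (PWhen (Edge 3 5) (PWhen (Neq (Var 4) (Var 5))
      (PWhen (Colour 4) (PWhen (Defs.Sub (Const 1) (Neq (Colour 4) (Colour 5)))
        (PStore 1 (Var 3) (Colour 4))))))))).

Definition count_mates : prog :=
  PSeq (PAssign 7 (Const 0))
       (PFor 4 (PWhen (Edge 3 4) (PWhen (Neq (Side 3) (Side 4))
         (PAssign 7 (Add (Var 7) (Const 1)))))).

(** The answer is only ever set to 1, so an accepting guess is not forgotten. *)
Definition check : prog :=
  PSeq (PAssign 6 (Const 1))
  (PSeq (PFor 3 (PSeq count_mates
           (PWhen (Neq (Var 7) (Const 1)) (PAssign 6 (Const 0)))))
        (PWhen (Var 6) (PAssign 1 (Const 1)))).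

Definition try_guess : prog := PSeq (plant_all 8) (PSeq propagate check).

Fixpoint guess (k : nat) : prog :=
  if k is k'.+1 then PFor (10 + k') (guess k') else try_guess.

(** For n = 0 no guess is ever tried; the empty graph has the empty perfect
    matching cut, hence the initial answer 1 - n. *)
Definition decide : prog :=
  PSeq tabulate_rows
  (PSeq (PAssign 1 (Defs.Sub (Const 1) (Var 0)))
  (PSeq (guess 16) (PAssign 0 (Var 1)))).

Lemma den_seq p q s : den (PSeq p q) s = den q (den p s).
Proof. by []. Qed.

Lemma den_when e p s :
  den (PWhen e p) s = if eval s e != 0 then den p s else s.
Proof. by []. Qed.

Lemma eval_Neq s e f : (eval s (Neq e f) != 0) = (eval s e != eval s f).
Proof. rewrite /=; lia. Qed.

Lemma plant_all_wregs k : wregs (plant_all k) =i [:: 3].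
Proof. by elim: k => // k IHk x; rewrite /= mem_cat IHk !inE; case: (x == 3). Qed.

Lemma plant_all_warrs k : warrs (plant_all k) =i [:: 1].
Proof. by elim: k => // k IHk x; rewrite /= mem_cat IHk !inE; case: (x == 1). Qed.

(** * Correctness of the algorithm *)

Section Correctness.

Variables (n : nat) (G : sgraph 'I_n).

Definition loaded (s : state) : Prop :=
  reg s 0 = n /\ forall v w : 'I_n, arr s 0 (arr s 2 v + w) = adj G v w.

Lemma loaded_unchanged rs ars s s' :
  unchanged rs ars s s' -> 0 \notin rs -> 0 \notin ars -> 2 \notin ars ->
  loaded s -> loaded s'.
Proof.
move=> [rU aU] r0 a0 a2 [s0 sA]; split; first by rewrite rU.
by move=> v w; rewrite !aU.
Qed.

Lemma loaded_den p s :
  0 \notin wregs p -> 0 \notin warrs p -> 2 \notin warrs p ->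
  loaded s -> loaded (den p s).
Proof. exact: loaded_unchanged (den_unchanged p s). Qed.

Lemma eval_Edge s x y (v w : 'I_n) :
  loaded s -> reg s x = v -> reg s y = w -> eval s (Edge x y) = adj G v w.
Proof. by move=> [_ sA] /= -> ->. Qed.

(** Entry v * n + w of the matrix determines v and w, by division with
    remainder. *)
Lemma loaded_tabulate_rows : loaded (den tabulate_rows (input G)).
Proof.
have [_ rows] : reg (den tabulate_rows (input G)) 2 = n * n /\
    forall v : 'I_n, arr (den tabulate_rows (input G)) 2 v = v * n.
  have := @for_invariant n 3
    (PSeq (PStore 2 (Var 3) (Var 2)) (PAssign 2 (Add (Var 2) (Var 0))))
    (fun i s => reg s 2 = i * n /\ forall v : 'I_n, v < i -> arr s 2 v = v * n)
    (input G).
  case=> //= [i s' [rU _] s3 [s2 sA]|r2 rows]; last by split=> // v; apply: rows.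
  rewrite /= (rU 0) //= s2 s3 mulSnr; split=> // v; rewrite ltnS.
  by case: (eqVneq (v : nat) i) => [->|ne vi] //; apply: sA; rewrite ltn_neqAle ne.
have U := den_unchanged tabulate_rows (input G).
split; first by rewrite U.1.
move=> v w; rewrite U.2 // rows /=; congr nat_of_bool.
apply/existsP/idP => [[i /existsP[j /andP[/eqP e ij]]]|vw]; last first.
  by exists v; apply/existsP; exists w; rewrite eqxx.
have n0 : 0 < n by apply: leq_trans (ltn_ord v).
have ev : v = i.
  by apply: val_inj; have := congr1 (divn^~ n) e; rewrite !divnMDl // !divn_small // !addn0.
have ew : w = j.
  by apply: val_inj; have := congr1 (modn^~ n) e; rewrite !modnMDl !modn_small.
by rewrite ev ew.
Qed.

Section Painting.

Variable A : {set 'I_n}.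
Hypothesis cutA : cut_side G A.

Definition code (v : 'I_n) : nat := if v \in A then 1 else 2.

(** The colouring array is correct for the cut A wherever it is defined, and it
    is defined at least on D. *)
Definition paints (D : {set 'I_n}) (s : state) : Prop :=
  forall v : 'I_n, arr s 1 v = code v \/ v \notin D /\ arr s 1 v = 0.

Lemma paintsS (D E : {set 'I_n}) s : E \subset D -> paints D s -> paints E s.
Proof.
move=> /subsetP ED pD v; case: (pD v) => [|[vD v0]]; [by left|right; split=> //].
by apply: contraNN vD => /ED.
Qed.

Lemma paints_store (D : {set 'I_n}) s (u c : nat) (v : 'I_n) :
  u = v -> c = code v -> paints D s -> paints (v |: D) (set_arr s 1 u c).
Proof.
move=> -> -> pD w /=; case: eqVneq => [/val_inj->|ne]; first by left.
case: (pD w) => [|[wD w0]]; [by left|right; rewrite !inE negb_or wD andbT; split=> //].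
Qed.

(** D0 is a lower bound, kept along the loop, for what is coloured when an
    iteration starts: the set F i that iteration i adds may depend on it.  D
    itself has to vary, since nested loops use the lemma on intermediate
    states. *)
Lemma paint_for x b (D0 : {set 'I_n}) (F : 'I_n -> {set 'I_n}) s :
  wf (PFor x b) -> reg s 0 = n ->
  (forall (i : 'I_n) s' (D : {set 'I_n}),
     unchanged (x :: wregs b) (warrs b) s s' -> reg s' x = i ->
     D0 \subset D -> paints D s' -> paints (F i :|: D) (den b s')) ->
  forall D : {set 'I_n}, D0 \subset D -> paints D s ->
    paints ((\bigcup_i F i) :|: D) (den (PFor x b) s).
Proof.
move=> wfb s0 step D D0D pD.
have: paints ((\bigcup_(j : 'I_n | j < n) F j) :|: D) (den (PFor x b) s).
  apply: (@for_invariant n x b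
    (fun i s => paints ((\bigcup_(j : 'I_n | j < i) F j) :|: D) s)) => //.
    by rewrite big_pred0 // set0U.
  move=> i s' U s'x pi.
  have := step i s' _ U s'x (subset_trans D0D (subsetUr _ _)) pi.
  apply: paintsS; rewrite setUA; apply: setSU; apply/bigcupsP=> j.
  rewrite ltnS leq_eqVlt => /orP[/eqP/val_inj->|ji]; first exact: subsetUl.
  by apply: subset_trans (subsetUr _ _); apply: bigcup_sup.
apply: paintsS; apply: setSU; apply/bigcupsP=> i _.
by apply: bigcup_sup.
Qed.

Lemma den_uncolour s : reg s 0 = n -> paints set0 (den uncolour s).
Proof.
move=> s0 v; right; split; first by rewrite inE.
have := @for_invariant n 3 (PStore 1 (Var 3) (Const 0))
  (fun i s => forall v : 'I_n, v < i -> arr s 1 v = 0) s.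
apply=> // i s' U s'x IH w /=; rewrite s'x ltnS leq_eqVlt.
by case: eqVneq => //= _; apply: IH.
Qed.

Notation mate := (mate G A).
Notation reach := (reach G A).
Notation spread := (spread G A).


(** c is a condition known to imply the test.  The test itself may succeed more
    often, when it reads colours that happen to be defined outside of D; then the
    write must still be correct, but is not counted. *)
Lemma paint_when (c : bool) (E D : {set 'I_n}) e p s :
  (c -> eval s e != 0) -> (eval s e != 0 -> paints (E :|: D) (den p s)) ->
  paints D s -> paints ((if c then E else set0) :|: D) (den (PWhen e p) s).
Proof.
move=> ce pE pD /=; case: (boolP (eval s e != 0)) => [ne|e0].
  by apply: paintsS (pE ne); apply: setSU; case: (c); rewrite ?sub0set.
by case: c ce => [|_]; [move=> /(_ isT); rewrite (negbTE e0)|rewrite set0U].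
Qed.

Lemma paint_when_edge x y (v w : 'I_n) (E D : {set 'I_n}) p s :
  loaded s -> reg s x = v -> reg s y = w ->
  (adj G v w -> paints (E :|: D) (den p s)) -> paints D s ->
  paints ((if adj G v w then E else set0) :|: D) (den (PWhen (Edge x y) p) s).
Proof.
move=> ls sx sy pE; apply: paint_when; rewrite (eval_Edge ls sx sy) eqb0 negbK //.
Qed.

Lemma paint_when_neq x y (v w : 'I_n) (E D : {set 'I_n}) p s :
  reg s x = v -> reg s y = w ->
  (v != w -> paints (E :|: D) (den p s)) -> paints D s ->
  paints ((if v != w then E else set0) :|: D)
         (den (PWhen (Neq (Var x) (Var y)) p) s).
Proof.
by move=> sx sy pE; apply: paint_when; rewrite eval_Neq /= sx sy.
Qed.

(** What [mark] adds for counter value i, in the form produced by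
    [paint_when_edge] and [paint_when_neq]. *)
Definition kin (y z i : 'I_n) : {set 'I_n} :=
  if adj G y i then if i != z then [set i] else set0 else set0.

Lemma den_mark x x' c (y i : 'I_n) (D : {set 'I_n}) s :
  loaded s -> reg s x = y -> reg s x' = mate y -> reg s 3 = i -> c = code y ->
  paints D s -> paints (kin y (mate y) i :|: D) (den (mark x x' c) s).
Proof.
move=> ls sx sx' s3 ec pD.
apply: (paint_when_edge ls sx s3) => // yi.
apply: (paint_when_neq s3 sx') => // ne.
rewrite /=; apply: paints_store => //; rewrite ec /code.
suff ->: (y \in A) = (i \in A) by [].
apply/eqP; rewrite eq_sym; apply: contraNT ne => opp.
by rewrite (mateE cutA yi opp).
Qed.

Lemma den_plant a b (u : 'I_n) (D : {set 'I_n}) s :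
  a != 3 -> b != 3 -> loaded s -> reg s a = u -> reg s b = mate u -> u \in A ->
  paints D s -> paints (reach [:: u] :|: D) (den (plant a b) s).
Proof.
move=> a3 b3 ls sa sb uA pD.
have muA: mate u \notin A by rewrite mate_opposite // uA.
have pL : paints ((\bigcup_i (kin (mate u) u i :|: kin u (mate u) i)) :|: D)
    (den (PFor 3 (PSeq (mark a b 1) (mark b a 2))) s).
  apply: (@paint_for _ _ set0) => //; [exact: ls.1| |exact: sub0set].
  move=> i s' E U s'3 _ pE; rewrite -setUA den_seq.
  have ls' : loaded s' by apply: loaded_unchanged U _ _ _ ls.
  have s'a : reg s' a = u by rewrite U.1 ?inE // (negbTE a3).
  have s'b : reg s' b = mate u by rewrite U.1 ?inE // (negbTE b3).
  have pE' := den_mark ls' s'a s'b s'3 _ pE.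
  rewrite -{2}(mateK cutA u); apply: den_mark; rewrite ?(mateK cutA) ?den_reg //.
  - exact: loaded_den.
  - by rewrite /code (negbTE muA).
  - by apply: pE'; rewrite /code uA.
rewrite /plant den_seq; set t := den _ _ in pL *; rewrite /=.
have ta : reg t a = u by rewrite /t den_reg ?inE.
have tb : reg t b = mate u by rewrite /t den_reg ?inE.
have := paints_store (u := reg t a) (c := 1) ta _ pL; rewrite /code uA => /(_ erefl).
move/(paints_store (u := reg t b) (c := 2) tb); rewrite /code (negbTE muA) => /(_ erefl).
apply: paintsS; apply/subsetP=> v; rewrite !inE /= orbF.
have inF (y z i : 'I_n) : adj G y i -> i != z -> i \in kin y z i.
  by rewrite /kin => -> ->; rewrite set11.
have [//|vm] := eqVneq v (mate u); have [//|vu /=] := eqVneq v u.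
case/orP=> [/orP[uv|uv]|->]; rewrite ?orbT //; apply/orP; left; apply/bigcupP; exists v => //.
  by rewrite inE (inF u) ?orbT.
by rewrite inE (inF (mate u)).
Qed.

Lemma den_plant_all (u : nat -> 'I_n) k s :
  loaded s ->
  (forall i, i < k -> [/\ reg s (10 + i.*2) = u i, reg s (11 + i.*2) = mate (u i)
                        & u i \in A]) ->
  paints (reach (mkseq u k)) (den (plant_all k) s).
Proof.
move=> ls; elim: k => [|k IHk] us.
  by apply: paintsS (den_uncolour ls.1); apply/subsetP=> v; rewrite inE.
rewrite mkseqS -cats1 reach_cat setUC.
have [sa sb uA] := us k (ltnSn k).
rewrite [den _ _]/= -/(den (plant _ _) _); apply: den_plant => //.
- by apply: loaded_den; rewrite ?plant_all_wregs ?plant_all_warrs.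
- by rewrite den_reg // plant_all_wregs inE.
- by rewrite den_reg // plant_all_wregs inE.
- by apply: IHk => i ik; apply: us; apply: ltnW.
Qed.

(** The array is updated in place, so colours written early may be read later in
    the same loop.  This can only colour more vertices than one round of
    [spread], and never wrongly. *)
Lemma den_propagate (D : {set 'I_n}) s :
  loaded s -> paints D s -> paints (spread D) (den propagate s).
Proof.
move=> ls pD.
(* The membership of i is asked twice: once for the test that the colour of i
   is nonzero, once for the comparison of the colours of i and j. *)
pose F (v i j : 'I_n) : {set 'I_n} :=
  if adj G v i then if adj G v j then if i != j then
    if i \in D then if [&& i \in D, j \in D & (i \in A) == (j \in A)] then [set v]
    else set0 else set0 else set0 else set0 else set0.
have: paints ((\bigcup_v \bigcup_i \bigcup_j F v i j) :|: D) (den propagate s).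
  apply: (@paint_for _ _ D) => //; first exact: ls.1.
  move=> v s1 E1 U1 s1v DE1 pE1.
  have ls1 : loaded s1 by apply: loaded_unchanged U1 _ _ _ ls.
  apply: (@paint_for _ _ D) => //; first exact: ls1.1.
  move=> i s2 E2 U2 s2i DE2 pE2.
  have ls2 : loaded s2 by apply: loaded_unchanged U2 _ _ _ ls1.
  apply: (@paint_for _ _ D) => //; first exact: ls2.1.
  move=> j s3 E U3 s3j DE pE.
  have ls3 : loaded s3 by apply: loaded_unchanged U3 _ _ _ ls2.
  have s3i : reg s3 4 = i by rewrite U3.1.
  have s3v : reg s3 3 = v by rewrite U3.1 // U2.1.
  have col k : k \in D -> arr s3 1 k = code k.
    by move=> kD; case: (pE k) => // -[/negP[]]; apply: (subsetP DE).
  apply: (paint_when_edge ls3 s3v s3i) => // vi.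
  apply: (paint_when_edge ls3 s3v s3j) => // vj.
  apply: (paint_when_neq s3i s3j) => // ij.
  apply: paint_when => // [iD|ci].
    by rewrite /= s3i col // /code; case: ifP.
  have {}ci : arr s3 1 i != 0 by move: ci; rewrite /= s3i.
  have eval_same : (eval s3 (Defs.Sub (Const 1) (Neq (Colour 4) (Colour 5))) != 0)
      = (arr s3 1 i == arr s3 1 j).
    have := eval_Neq s3 (Colour 4) (Colour 5); rewrite /= s3i s3j; lia.
  apply: paint_when; rewrite ?eval_same //.
    by case/and3P=> iD jD /eqP eij; rewrite !col // /code eij.
  move=> cij; rewrite /=; apply: paints_store => //=; rewrite s3i.
  have known (k : 'I_n) : arr s3 1 k != 0 -> arr s3 1 k = code k.
    by case: (pE k) => // -[_ ->].
  move: (cij); rewrite (known i ci) (known j) -?(eqP cij) // => /eqP eij.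
  have {}eij : (i \in A) = (j \in A).
    by move: eij; rewrite /code; case: (i \in A); case: (j \in A).
  rewrite /code; suff -> : (i \in A) = (v \in A) by [].
  apply/eqP; apply: contraNT ij => opp.
  rewrite (mateE cutA vi opp) (mateE cutA vj) //.
  by rewrite -eij.
apply: paintsS; apply/subsetP=> v; rewrite !inE.
case/orP=> [->|]; first by rewrite orbT.
case/existsP=> i /andP[iD /existsP[j /andP[jD /and4P[ij vi vj eij]]]].
apply/orP; left; apply/bigcupP; exists v => //; apply/bigcupP; exists i => //.
apply/bigcupP; exists j => //.
by rewrite /F vi vj ij iD jD eij set11.
Qed.

End Painting.

(** The set A that the final check tests, in agreement with [Side]. *)
Definition low (s : state) : {set 'I_n} := [set v : 'I_n | arr s 1 v <= 1].

Lemma card_prefix (M : {set 'I_n}) (i : 'I_n) :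
  #|[set w in M | w < i.+1]| = #|[set w in M | w < i]| + (i \in M).
Proof.
have [iM|iM] := boolP (i \in M); last first.
  rewrite addn0; apply: eq_card => w; rewrite !inE ltnS leq_eqVlt val_eqE.
  by case: eqVneq => [->|]; rewrite ?(negbTE iM).
have := cardsU1 i [set w in M | w < i]; rewrite inE ltnn andbF addnC => <-.
apply: eq_card => w; rewrite !inE ltnS leq_eqVlt val_eqE.
by case: eqVneq => [->|] //; rewrite iM.
Qed.

Lemma den_count_mates s (v : 'I_n) :
  loaded s -> reg s 3 = v -> reg (den count_mates s) 7 = #|mates G (low s) v|.
Proof.
move=> ls s3; rewrite /count_mates den_seq; set s0 := den _ s.
have ->: #|mates G (low s) v| = #|[set w in mates G (low s) v | w < n]|.
  by apply: eq_card => w; rewrite !inE ltn_ord andbT.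
apply: (@for_invariant n 4 _
  (fun i s' => reg s' 7 = #|[set w in mates G (low s) v | w < i]|)) => //.
- exact: ls.1.
- by rewrite /= (eq_card0 (A := [set w in _ | _])) // => w; rewrite !inE ltn0 andbF.
move=> i s' U s'4 cnt.
have ls' : loaded s' by apply: loaded_unchanged U _ _ _ ls.
have s'3 : reg s' 3 = v by rewrite U.1.
have sides : (eval s' (Neq (Side 3) (Side 4)) != 0) = ((i \in low s) != (v \in low s)).
  have ea w : arr s' 1 w = arr s 1 w by rewrite U.2.
  rewrite eval_Neq /= s'3 s'4 !ea !inE; case: leqP; case: leqP; lia.
have iM : (i \in mates G (low s) v) = adj G v i && (eval s' (Neq (Side 3) (Side 4)) != 0).
  by rewrite sides inE.
rewrite card_prefix iM -cnt; move: (eval_Edge ls' s'3 s'4) => ee.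
rewrite !den_when ee; case: (adj G v i); last by rewrite addn0.
by case: ifP; rewrite ?addn0.
Qed.

Lemma den_check s : loaded s ->
  (reg (den check s) 1 != 0) =
  (reg s 1 != 0) || [forall v, #|mates G (low s) v| == 1].
Proof.
move=> ls; rewrite /check den_seq den_seq; set s0 := den _ s.
set loop := PFor _ _.
have ok : (reg (den loop s0) 6 != 0) =
    [forall v : 'I_n, (v < n) ==> (#|mates G (low s) v| == 1)].
  apply: (@for_invariant n 3 _
    (fun i s' => (reg s' 6 != 0) =
       [forall v : 'I_n, (v < i) ==> (#|mates G (low s) v| == 1)])) => //.
  - exact: ls.1.
  - by apply/esym/forallP=> v; rewrite ltn0.
  move=> i s' U s'3 IH.
  have ls' : loaded s' by apply: loaded_unchanged U _ _ _ ls.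
  have els : low s' = low s by apply/setP=> v; rewrite !inE U.2.
  have cnt := den_count_mates ls' s'3; rewrite els in cnt.
  have s'6 : reg (den count_mates s') 6 = reg s' 6 by rewrite den_reg.
  have ev := eval_Neq (den count_mates s') (Var 7) (Const 1); rewrite [X in _ = X]/= cnt in ev.
  transitivity ((reg s' 6 != 0) && (#|mates G (low s) i| == 1)).
    rewrite den_seq; set t := den count_mates s' in ev s'6 *.
    rewrite den_when ev.
    by case: (#|_| == 1) => /=; rewrite ?s'6 ?andbT ?andbF.
  rewrite IH; apply/andP/forallP => [[/forallP all ei] v|all].
    rewrite ltnS leq_eqVlt; apply/implyP=> /orP[/eqP/val_inj->//|vi].
    exact: implyP (all v) vi.
  split; last by have := all i; rewrite ltnSn.
  by apply/forallP=> v; apply/implyP=> vi; apply: implyP (all v) _; rewrite ltnW.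
have r1 : reg (den loop s0) 1 = reg s 1 by rewrite den_reg.
have -> : [forall v, #|mates G (low s) v| == 1] = (reg (den loop s0) 6 != 0).
  by rewrite ok; apply: eq_forallb => v; rewrite ltn_ord.
by rewrite /=; case: (reg (den loop s0) 6 != 0) => /=; rewrite ?orbT ?orbF ?r1.
Qed.

(** The invariant for soundness: a positive answer so far is right. *)
Definition consistent (s : state) : Prop :=
  loaded s /\ (reg s 1 != 0 -> has_perfect_matching_cut G).

Lemma guess_wregs k x : x \in wregs (guess k) -> 0 < x /\ (x < 10 \/ 10 <= x < 10 + k).
Proof.
elim: k => [|k IHk] //=; first by rewrite !inE; lia.
rewrite inE => /orP[/eqP->|/IHk]; lia.
Qed.

Lemma wf_guess k : wf (guess k).
Proof.
elim: k => // k IHk /=; rewrite IHk inE andbT negb_or /=; apply/andP; split.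
  by apply/negP=> /guess_wregs[].
apply/negP=> /guess_wregs[]; lia.
Qed.

(** The values of the guess registers decide: no other register, and no colour
    left over from an earlier guess, can make the trial fail. *)
Definition winning (g : nat -> nat) : Prop :=
  forall s, loaded s -> (forall i, i < 16 -> reg s (10 + i) = g i) ->
  reg (den try_guess s) 1 != 0.

Lemma try_guess_consistent s :
  consistent s -> consistent (den try_guess s) /\
  (reg s 1 != 0 -> reg (den try_guess s) 1 != 0).
Proof.
move=> [ls Qs]; set t := den propagate (den (plant_all 8) s).
have lt : loaded t by do 2!apply: loaded_den => //.
have t1 : reg t 1 = reg s 1 by rewrite /t !den_reg.
rewrite /try_guess (den_seq (plant_all 8)) (den_seq propagate) -/t.
split; [split|]; rewrite ?den_check ?t1 //; first exact: loaded_den.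
  case/orP=> // /forallP all; apply/has_perfect_matching_cutP.
  by exists (low t) => v; apply/eqP.
by move=> ->.
Qed.

Lemma guess_consistent k s :
  consistent s -> consistent (den (guess k) s) /\
  (reg s 1 != 0 -> reg (den (guess k) s) 1 != 0).
Proof.
elim: k s => [|k IHk] s cs; first exact: try_guess_consistent.
apply: (@for_invariant n (10 + k) (guess k)
  (fun _ s' => consistent s' /\ (reg s 1 != 0 -> reg s' 1 != 0))).
- exact: wf_guess k.+1.
- exact: cs.1.1.
- exact: conj cs _.
move=> i s' _ _ [cs' s1]; have [ct t1] := IHk s' cs'.
by split=> [|/s1/t1 //]; exact: ct.
Qed.

(** The guess registers of the loops still to come, those below 10 + k, have to
    be reached by enumeration; the others already have the values of g. *)
Lemma guess_wins k s (g : nat -> nat) :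
  consistent s -> (forall i, i < k -> g i < n) ->
  (forall i, k <= i < 16 -> reg s (10 + i) = g i) -> k <= 16 -> winning g ->
  reg (den (guess k) s) 1 != 0.
Proof.
move=> + + + + win; elim: k s => [|k IHk] s cs gn sg k16.
  by apply: win => [|i i16]; [exact: cs.1|exact: sg].
have := @for_invariant n (10 + k) (guess k)
  (fun i s' => consistent s' /\ (g k < i -> reg s' 1 != 0)) s.
case=> //.
- exact: wf_guess k.+1.
- exact: cs.1.1.
- move=> i s' U s'k [cs' w']; have [ct t1] := guess_consistent k cs'.
  split=> //= ; rewrite ltnS leq_eqVlt => /orP[/eqP gi|/w'/t1 //].
  apply: IHk => // [j jk|j /andP[kj j16]|]; last exact: ltnW.
    by apply: gn; apply: ltnW.
  case: (eqVneq j k) => [->|jk]; first by rewrite s'k gi.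
  rewrite U.1; first by apply: sg; rewrite j16 andbT ltn_neqAle eq_sym jk.
  by apply/negP=> /(@guess_wregs k.+1)[]; lia.
- by move=> _; apply; apply: gn.
Qed.

Lemma cut_wins (A : {set 'I_n}) (v0 : 'I_n) :
  bipartite G -> diameter_at_most G 3 -> cut_side G A ->
  exists2 g : nat -> nat, (forall i, g i < n) & winning g.
Proof.
move=> bipG diamG cutA.
have [us [us8 usA] us_all] := eight_edges_suffice bipG diamG cutA v0.
pose u i := nth v0 us i.
pose h i : 'I_n := if odd i then mate G A (u i./2) else u i./2.
exists (fun i => h i : nat) => // s ls sh.
set t := den propagate (den (plant_all 8) s).
have lt : loaded t by do 2!apply: loaded_den => //.
rewrite /try_guess (den_seq (plant_all 8)) (den_seq propagate) -/t.
rewrite den_check //; apply/orP; right.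
have pt : paints A [set: 'I_n] t.
  rewrite -us_all; apply: den_propagate => //; first exact: loaded_den.
  have -> : us = mkseq u 8 by rewrite -us8 mkseq_nth.
  apply: den_plant_all => // i i8; split.
  - by rewrite sh /h ?odd_double ?doubleK //; lia.
  - rewrite -[11]/(10 + 1) -addnA sh; last by lia.
    by rewrite add1n /h /= odd_double uphalf_double.
  - by apply: usA; apply: mem_nth; rewrite us8.
have -> : low t = A.
  apply/setP=> v; rewrite inE; case: (pt v) => [->|[]]; last by rewrite inE.
  by rewrite /code; case: (v \in A).
by apply/forallP=> v; rewrite cutA.
Qed.

Lemma decide_correct :
  bipartite G -> diameter_at_most G 3 ->
  reg (den decide (input G)) 0 != 0 <-> has_perfect_matching_cut G.
Proof.
move=> bipG diamG; set s := den tabulate_rows (input G).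
have ls : loaded s := loaded_tabulate_rows.
set t := set_reg s 1 (1 - n).
have -> : reg (den decide (input G)) 0 = reg (den (guess 16) t) 1.
  rewrite /decide (den_seq tabulate_rows) (den_seq (PAssign 1 _)) (den_seq (guess 16)) -/s.
  by rewrite [den (PAssign 1 _) s]/= ls.1.
have ct : consistent t.
  split; first exact: ls.
  rewrite /= subn_eq0 -ltnNge ltnS leqn0 => /eqP n0.
  apply/has_perfect_matching_cutP; exists set0 => v.
  by have := ltn_ord v; rewrite [X in _ < X]n0.
split; first by case: (guess_consistent 16 ct) => -[].
case/has_perfect_matching_cutP=> A cutA.
case: (posnP n) => [n0|n_gt0].
  by apply: (guess_consistent 16 ct).2; rewrite /= n0.
have [g gn win] := cut_wins (Ordinal n_gt0) bipG diamG cutA.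
apply: (guess_wins ct _ _ _ win) => // i; lia.
Qed.

End Correctness.

Theorem theorem9 :
  poly_time_solvable_on
    (fun (V : finType) (G : sgraph V) => bipartite G /\ diameter_at_most G 3)
    (fun (V : finType) (G : sgraph V) => has_perfect_matching_cut G).
Proof.
have wf_decide : wf decide.
  by rewrite /decide /= ?wf_guess.
have [K [d run]] := compile_correct wf_decide.
exists (compile decide), (K * 2 ^ d), d => n G [bipG diamG].
have [t et lt] := run (input G).
exists t, (den decide (input G)); split=> //; last exact: decide_correct.
apply: (leq_trans lt); rewrite /= -mulnA -mulnDr leq_mul2l; apply/orP; right.
case: (posnP n) => [->|n_gt0].
  by rewrite exp1n addn_gt0 !expn_gt0 orbT.
apply: leq_trans (leq_addr _ _); rewrite -expnMn.
by case: (d) => // e; rewrite leq_exp2r; lia.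
Qed.
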